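(* Let $R$ be a ring, let $p$ be a prime, and let $G$ be a group. If $G$ is a locally finite $p$-group, $p \in \mathrm{Nil}(R)$ (i.e. $p\cdot 1_R$ is nilpotent in $R$), and $R$ is generalized fine, then the group ring $RG$ is generalized fine.
   Context: Rings are associative with identity, not necessarily commutative. For a ring $R$, $J(R)$ is its Jacobson radical and $\mathrm{Nil}(R)$ its set of nilpotent elements. A ring $R$ is generalized fine if every element of $R \setminus J(R)$ is the sum of a unit and a nilpotent element of $R$. $RG$ denotes the group ring of $G$ over $R$. A group is a $p$-group if every element has finite order equal to a power of $p$; it is locally finite if every finitely generated subgroup is finite. *)

(* Defs.v *)
From HB Require Import structures.
From mathcomp Require Import all_boot all_order all_algebra finmap.
From mathcomp Require Import boolp classical_sets cardinality.
From mathcomp Require Import monalg.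

Set Implicit Arguments.
Unset Strict Implicit.
Unset Printing Implicit Defensive.

Import GRing.Theory.

Local Open Scope classical_set_scope.
Local Open Scope ring_scope.

(* Rings are [pzRingType]s: associative with identity, not necessarily
   commutative, and the zero ring is allowed. *)
Section RingNotions.
Context (R : pzRingType).

Definition left_ideal (I : set R) : Prop :=
  [/\ I 0,
      forall x y, I x -> I y -> I (x - y)
    & forall a x, I x -> I (a * x)].

Definition maximal_left_ideal (I : set R) : Prop :=
  [/\ left_ideal I,
      I <> setT
    & forall K : set R, left_ideal K -> K <> setT -> I `<=` K -> K = I].

Definition jacobson_radical : set R :=
  \bigcap_(I in maximal_left_ideal) I.

Definition nilpotents : set R := [set x | exists n : nat, x ^+ n = 0].

Definition units : set R := [set u | exists v, u * v = 1 /\ v * u = 1].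

Definition generalized_fine : Prop :=
  forall x, ~ jacobson_radical x ->
    exists u v, [/\ units u, nilpotents v & x = u + v].

End RingNotions.

Arguments jacobson_radical : clear implicits.
Arguments nilpotents : clear implicits.
Arguments units : clear implicits.
Arguments generalized_fine : clear implicits.

Section GroupNotions.
Context (G : groupType).
Local Open Scope group_scope.

Definition is_subgroup (H : set G) : Prop :=
  [/\ H 1,
      forall x y, H x -> H y -> H (x * y)
    & forall x, H x -> H x^-1].

Definition generated_subgroup (A : set G) : set G := smallest is_subgroup A.

Definition locally_finite : Prop :=
  forall A : set G, finite_set A -> finite_set (generated_subgroup A).

Definition has_order (g : G) (n : nat) : Prop :=
  [/\ (0 < n)%N, g ^+ n = 1
    & forall m : nat, (0 < m)%N -> g ^+ m = 1 -> (n <= m)%N].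

Definition is_pgroup (p : nat) : Prop :=
  forall g : G, exists k : nat, has_order g (p ^ k)%N.

End GroupNotions.

Arguments locally_finite : clear implicits.
Arguments is_pgroup : clear implicits.

(* The additive group of RG is that of the finitely supported functions
   {malg R[G]}. The product of monalg.v is not available on it, because that
   file only multiplies over monoids without nontrivial units, so we equip a
   separate copy with the convolution product. *)
Definition group_ring (R : pzRingType) (G : groupType) : predArgType :=
  {malg R[G]}.

Section GroupRing.
Context (R : pzRingType) (G : groupType).

HB.instance Definition _ := GRing.Zmodule.on (group_ring R G).

Implicit Types (a b c : group_ring R G) (x y : R) (g h : G).

Definition gr_one : group_ring R G := mkmalgU 1%g 1.

Definition gr_mul a b : group_ring R G :=
  \sum_(g <- msupp a) \sum_(h <- msupp b)
    mkmalgU (g * h)%g (mcoeff g a * mcoeff h b).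

Lemma gr_mulw (d1 d2 : {fset G}) a b :
  (msupp a `<=` d1)%fset -> (msupp b `<=` d2)%fset ->
  gr_mul a b = \sum_(g <- d1) \sum_(h <- d2)
    mkmalgU (g * h)%g (mcoeff g a * mcoeff h b).
Proof.
move=> le1 le2; rewrite /gr_mul (big_fset_incl _ le1) /=.
  apply/eq_bigr => g _; apply/big_fset_incl => // h _ /mcoeff_outdom ->.
  by rewrite mulr0 monalgU0.
move=> g _ /mcoeff_outdom ag; rewrite big1 // => h _.
by rewrite ag mul0r monalgU0.
Qed.

Lemma gr_mulUU g h x y :
  gr_mul (mkmalgU g x) (mkmalgU h y) = mkmalgU (g * h)%g (x * y).
Proof. by rewrite (gr_mulw msuppU_le msuppU_le) !big_seq_fset1 !mcoeffUU. Qed.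

Lemma gr_mulDl : left_distributive gr_mul +%R.
Proof.
move=> a b c; set d := (msupp a `|` msupp b)%fset.
have [la lb] : (msupp a `<=` d)%fset /\ (msupp b `<=` d)%fset.
  by split; [exact: fsubsetUl | exact: fsubsetUr].
have le := fsubset_refl (msupp c).
rewrite (gr_mulw (msuppD_le a b) le) (gr_mulw la le) (gr_mulw lb le).
rewrite -big_split; apply/eq_bigr => g _.
rewrite -big_split; apply/eq_bigr => h _ /=.
by rewrite mcoeffD mulrDl monalgUD.
Qed.

Lemma gr_mulDr : right_distributive gr_mul +%R.
Proof.
move=> c a b; set d := (msupp a `|` msupp b)%fset.
have [la lb] : (msupp a `<=` d)%fset /\ (msupp b `<=` d)%fset.
  by split; [exact: fsubsetUl | exact: fsubsetUr].
have le := fsubset_refl (msupp c).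
rewrite (gr_mulw le (msuppD_le a b)) (gr_mulw le la) (gr_mulw le lb).
rewrite -big_split; apply/eq_bigr => g _.
rewrite -big_split; apply/eq_bigr => h _ /=.
by rewrite mcoeffD mulrDr monalgUD.
Qed.

Lemma gr_mul0l : left_zero 0 gr_mul.
Proof. by move=> a; rewrite /gr_mul msupp0 big_seq_fset0. Qed.

Lemma gr_mul0r : right_zero 0 gr_mul.
Proof.
move=> a; rewrite /gr_mul big1 // => g _.
by rewrite msupp0 big_seq_fset0.
Qed.

Lemma gr_ind (P : group_ring R G -> Prop) :
  P 0 -> (forall a b, P a -> P b -> P (a + b)) ->
  (forall g x, P (mkmalgU g x)) -> forall a, P a.
Proof.
move=> P0 PD PU a; rewrite [a]monalgE.
by apply: (big_ind P) => // g _; exact: PU.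
Qed.

Lemma gr_mulA : associative gr_mul.
Proof.
move=> a b c; elim/gr_ind: a => [|a a' IH IH'|g x].
- by rewrite !gr_mul0l.
- by rewrite !gr_mulDl IH IH'.
elim/gr_ind: b => [|b b' IH IH'|h y].
- by rewrite gr_mul0l gr_mul0r gr_mul0l.
- by rewrite gr_mulDl !gr_mulDr gr_mulDl IH IH'.
elim/gr_ind: c => [|c c' IH IH'|k z].
- by rewrite !gr_mul0r.
- by rewrite !gr_mulDr IH IH'.
by rewrite !gr_mulUU mulrA mulgA.
Qed.

Lemma gr_mul1l : left_id gr_one gr_mul.
Proof.
elim/gr_ind => [|a b IH IH'|g x]; first by rewrite gr_mul0r.
  by rewrite gr_mulDr IH IH'.
by rewrite gr_mulUU mul1r mul1g.
Qed.

Lemma gr_mul1r : right_id gr_one gr_mul.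
Proof.
elim/gr_ind => [|a b IH IH'|g x]; first by rewrite gr_mul0l.
  by rewrite gr_mulDl IH IH'.
by rewrite gr_mulUU mulr1 mulg1.
Qed.

HB.instance Definition _ := GRing.Zmodule_isPzRing.Build (group_ring R G)
  gr_mulA gr_mul1l gr_mul1r gr_mulDl gr_mulDr.

End GroupRing.

(* Main.v *)
(* The augmentation kernel is a nil ideal, so units, nilpotents and the Jacobson
   radical pass between R and RG, and u + v lifts a decomposition modulo it.
   For nilness, an element of the kernel is a combination of elements g - 1 with
   g in a finite p-subgroup P, and a long enough product of such factors
   vanishes. This goes by induction on |P|: if M is maximal in P and x lies in
   P but not in M, the elements killed by all products of j factors from M form
   a filtration; on its quotients M acts trivially, so (x - 1)^p acts there as p
   times a polynomial in x, and p is nilpotent. *)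
Require Import Defs.
From HB Require Import structures.
From mathcomp Require Import boolp classical_sets cardinality.
From mathcomp Require Import all_boot all_order all_algebra.
From mathcomp Require Import all_fingroup all_solvable finmap monalg.

Set Implicit Arguments.
Unset Strict Implicit.
Unset Printing Implicit Defensive.

Import GRing.Theory.

Local Open Scope ring_scope.

(** * Products of factors [f x - 1] over a finite p-group *)

Lemma expr1D_prime (S : pzRingType) (p : nat) (y : S) : prime p ->
  exists c : nat -> nat,
    (1 + y) ^+ p = 1 + y ^+ p + p%:R * \sum_(i < p) y ^+ i *+ c i.
Proof.
move=> p_pr; exists (fun i => if i == 0 then 0 else 'C(p, i) %/ p)%N.
case: p p_pr => // p p_pr.
rewrite exprDn_comm; last exact/commr_sym/commr1.
rewrite big_ord_recr big_ord_recl big_ord_recl /= subn0 subnn bin0 binn !mulr1n.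
rewrite !expr1n expr0 !mulr1 mul1r mulr0n add0r -!addrA; congr (_ + _).
rewrite addrC; congr (_ + _); rewrite mulr_sumr; apply: eq_bigr => i _.
rewrite expr1n mul1r mulrnAr mulr_natl -mulrnA mulnC divnK //.
by rewrite prime_dvd_bin //= ltnS ltn_ord.
Qed.

Section AugmentationProducts.
Variables (S : pzRingType) (gT : finGroupType) (f : gT -> S).
Implicit Types (A : {set gT}) (s t : seq gT) (v w : S).

Definition aug_prod s : S := \prod_(x <- s) (f x - 1).

(* The additive subgroups [aug_killed A j] filter [S] by the order to which
   the augmentation ideal of [A] annihilates an element from the left. *)
Definition aug_killed A (j : nat) v : Prop :=
  forall s, size s = j -> {subset s <= A} -> aug_prod s * v = 0.

Lemma aug_killed0 A j : aug_killed A j 0.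
Proof. by move=> s _ _; rewrite mulr0. Qed.

Lemma aug_killedD A j v w :
  aug_killed A j v -> aug_killed A j w -> aug_killed A j (v + w).
Proof. by move=> kv kw s ss sA; rewrite mulrDr kv // kw // addr0. Qed.

Lemma aug_killedN A j v : aug_killed A j v -> aug_killed A j (- v).
Proof. by move=> kv s ss sA; rewrite mulrN kv // oppr0. Qed.

Lemma aug_killedB A j v w :
  aug_killed A j v -> aug_killed A j w -> aug_killed A j (v - w).
Proof. by move=> kv kw; apply: aug_killedD => //; apply: aug_killedN. Qed.

Lemma aug_killedS A j v : aug_killed A j.+1 v ->
  forall x, x \in A -> aug_killed A j ((f x - 1) * v).
Proof.
move=> kv x xA s ss sA; rewrite mulrA.
have -> : aug_prod s * (f x - 1) = aug_prod (rcons s x).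
  by rewrite /aug_prod -cats1 big_cat big_seq1.
apply: kv => [|y]; first by rewrite size_rcons ss.
by rewrite mem_rcons inE => /predU1P[->|/sA].
Qed.

(** Multiplying by the sum lowers the killing order by one: each [c i] commutes past the product on
    its left, and [f (g i) - 1] uses up one factor. *)
Lemma aug_prod_nilpotent A (I : Type) (r : seq I) (c : I -> S) (g : I -> gT) n :
  (forall i, g i \in A) ->
  (forall i x, x \in A -> GRing.comm (c i) (f x)) ->
  (forall v, aug_killed A n v) ->
  (\sum_(i <- r) c i * (f (g i) - 1)) ^+ n = 0.
Proof.
move=> gA cA kn; set d := \sum_(_ <- _) _.
have dkill m v : aug_killed A m v -> d ^+ m * v = 0.
  elim: m v => [|m IH] v kv.
    by rewrite -(kv [::]) // /aug_prod big_nil.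
  rewrite exprSr -mulrA; apply: IH => s ss sA.
  rewrite /d mulr_suml mulr_sumr big1 // => i _.
  have cs : GRing.comm (c i) (aug_prod s).
    rewrite /aug_prod big_seq; elim/big_ind: _ => [|x y|x xs].
    - exact: commr1.
    - exact: commrM.
    - by apply: commrB; [apply: cA; apply: sA | apply: commr1].
  rewrite mulrA mulrA -cs -!mulrA (aug_killedS kv) ?mulr0 //.
by rewrite -[LHS]mulr1 dkill.
Qed.

Section PGroupStep.
Variables (p k : nat) (P M : {group gT}).
Hypotheses (p_pr : prime p) (pk0 : p%:R ^+ k = 0 :> S).
Hypotheses (pP : p.-group%g P) (maxM : maximal M P).
Hypothesis fM : {in P &, forall x y, f (x * y)%g = f x * f y}.
Hypothesis f1 : f 1%g = 1.

Let sMP : M \subset P.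
Proof. by have /maxgroupp/proper_sub := maxM. Qed.

Let nMP : (M <| P)%g.
Proof. exact: p_maximal_normal pP maxM. Qed.

(** Moving [f x] to the left of a product of factors from [M] conjugates them by [x], and they stay
    in [M] by normality. *)
Lemma aug_killed_stable j v x :
  x \in P -> aug_killed M j v -> aug_killed M j (f x * v).
Proof.
move=> xP kv s ss sM; rewrite mulrA.
have -> : aug_prod s * f x = f x * aug_prod [seq (y ^ x)%g | y <- s].
  elim: s sM {ss} => [|y s IH] sM; first by rewrite /aug_prod !big_nil mulr1 mul1r.
  have yM : y \in M by apply: sM; rewrite mem_head.
  have yP := subsetP sMP _ yM.
  have /IH e : {subset s <= M} by move=> z zs; apply: sM; rewrite inE zs orbT.
  rewrite /= /aug_prod !big_cons -!/(aug_prod _) -mulrA e !mulrA; congr (_ * _).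
  by rewrite mulrBl mulrBr mul1r mulr1 -!fM ?groupJ // conjgC.
rewrite -mulrA kv ?mulr0 ?size_map // => z /mapP[y /sM yM ->].
by rewrite memJ_norm // (subsetP (normal_norm nMP)).
Qed.

Lemma exprf x n : x \in P -> f (x ^+ n)%g = f x ^+ n.
Proof.
move=> xP; elim: n => [|n IH]; first by rewrite expg0 f1.
by rewrite expgS exprS fM ?groupX ?IH.
Qed.

Section Generator.
Variables (x : gT) (xP : x \in P) (xM : x \notin M).
Let X := f x.

(** A maximal subgroup of a p-group has index [p], so [x ^+ p] is trivial in the quotient by [M]. *)
Let xpM : (x ^+ p)%g \in M.
Proof.
have nx : x \in 'N(M)%g by rewrite (subsetP (normal_norm nMP)).
apply: coset_idr; first exact: groupX.
rewrite morphX //= -(p_maximal_index pP maxM) -card_quotient ?normal_norm //.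
by rewrite expg_cardG // mem_quotient.
Qed.

Let genP (t : gT) : t \in P -> exists a m, m \in M /\ t = (x ^+ a * m)%g.
Proof.
have -> : (P : {set gT}) = (<[x]> * M)%g.
  rewrite -norm_joinEl; last first.
    by rewrite cycle_subG (subsetP (normal_norm nMP)).
  have [_ mx] := maxgroupP maxM.
  (* If the join of [<[x]>] and [M] were proper in [P], maximality would make it [M], which omits
     [x]. *)
  apply/eqP; rewrite eq_sym eqEproper join_subG cycle_subG xP sMP.
  apply/negP => pr; have := mx (<[x]> <*> M)%G pr (joing_subr _ _) => e.
  by move: xM; rewrite -e /= (subsetP (joing_subl _ _)) ?cycle_id.
by case/mulsgP => _ m /cycleP[a ->] mM ->; exists a, m.
Qed.

(* Stands for the polynomials in [X]. *)
Let stable c : Prop := GRing.comm c X /\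
  forall j v, aug_killed M j v -> aug_killed M j (c * v).

Let stable1 : stable 1.
Proof. by split=> [|j v]; [apply: commr_sym; apply: commr1 | rewrite mul1r]. Qed.

Let stableM c d : stable c -> stable d -> stable (c * d).
Proof.
move=> [cX cs] [dX ds]; split=> [|j v kv]; last by rewrite -mulrA; auto.
by apply: commr_sym; apply: commrM; apply: commr_sym.
Qed.

Let stableN c : stable c -> stable (- c).
Proof.
move=> [cX cs]; split=> [|j v kv]; first by apply/commr_sym/commrN/commr_sym.
by rewrite mulNr; apply/aug_killedN/cs.
Qed.

Let stable_sum (I : Type) (r : seq I) (c : I -> S) :
  (forall i, stable (c i)) -> stable (\sum_(i <- r) c i).
Proof.
move=> sc; elim/big_ind: _ => // [|c1 c2 [c1X s1] [c2X s2]].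
  split=> [|j v _]; first by apply: commr_sym; apply: commr0.
  by rewrite mul0r; apply: aug_killed0.
split=> [|j v kv]; first by apply/commr_sym/commrD; apply/commr_sym.
by rewrite mulrDl; apply: aug_killedD; auto.
Qed.

Let stableX : stable X.
Proof. by split=> // j v; apply: aug_killed_stable. Qed.

Let stableXn c n : stable c -> stable (c ^+ n).
Proof. by move=> sc; elim: n => // n IH; rewrite exprS; apply: stableM. Qed.

Let stableMn c n : stable c -> stable (c *+ n).
Proof.
by move=> sc; rewrite -[n]card_ord -sumr_const -big_enum; apply: stable_sum.
Qed.

Let stableB1 : stable (X - 1).
Proof.
have -> : X - 1 = \sum_(b <- [:: false; true]) (if b then - 1 else X).
  by rewrite !big_cons big_nil addr0.
by apply: stable_sum => -[] //; apply: stableN.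
Qed.

Let stable_comm c : stable c -> GRing.comm c (X - 1).
Proof. by case=> cX _; apply: commrB => //; apply: commr1. Qed.

(** With [t = x ^+ a * m], [f t - 1] is [X ^+ a - 1] plus [X ^+ a * (f m - 1)]. The second term
    lowers the order by one since [m] is in [M]; the first is a geometric sum times [X - 1]. *)
Let reduce1 j (t : gT) : t \in P -> exists2 c, stable c &
  forall v, aug_killed M j.+1 v ->
    aug_killed M j ((f t - 1) * v - c * (X - 1) * v).
Proof.
move=> /genP[a [m [mM ->]]]; exists (\sum_(i < a) X ^+ i).
  by apply: stable_sum => i; apply: stableXn.
move=> v kv; have mP := subsetP sMP _ mM.
have -> : (\sum_(i < a) X ^+ i) * (X - 1) = X ^+ a - 1.
  rewrite subrX1; apply: stable_comm.
  by apply: stable_sum => i; apply: stableXn.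
rewrite fM ?groupX // exprf // -mulrBl -/X.
have -> : X ^+ a * f m - 1 - (X ^+ a - 1) = X ^+ a * (f m - 1).
  by rewrite opprB addrA subrK mulrBr mulr1.
rewrite -mulrA.
by have [_ ] := stableXn a stableX; apply; apply: aug_killedS.
Qed.

Let reduce j s : {subset s <= P} -> exists2 c, stable c &
  forall v, aug_killed M j.+1 v ->
    aug_killed M j (aug_prod s * v - c * (X - 1) ^+ size s * v).
Proof.
elim: s => [|t s IH] sP.
  exists 1 => // v kv; rewrite /aug_prod big_nil mulr1 subrr.
  exact: aug_killed0.
have tP : t \in P by apply: sP; rewrite mem_head.
have /IH[c sc cv] : {subset s <= P}.
  by move=> z zs; apply: sP; rewrite inE zs orbT.
have [d sd dv] := reduce1 j tP.
exists (d * c) => [|v kv]; first exact: stableM.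
have kv' : aug_killed M j.+1 (c * (X - 1) ^+ size s * v).
  by have [_] := stableM sc (stableXn (size s) stableB1); apply.
have k1 := dv _ kv'; have k2 := cv _ kv.
(* The error left by the tail of the list stays in layer [j] under [f t - 1], because [f t]
   preserves the layer. *)
have k3 := aug_killedB (aug_killed_stable tP k2) k2.
have E u : f t * u - u = (f t - 1) * u by rewrite mulrBl mul1r.
have := aug_killedD k1 k3; rewrite E (mulrBr (f t - 1)) addrC addrA addrNK.
rewrite /aug_prod big_cons -/(aug_prod s) exprS !mulrA.
by rewrite -[d * (X - 1) * c]mulrA -(stable_comm sc) !mulrA.
Qed.

(** Expand [X ^+ p] around [1]: since [x ^+ p] lies in [M], [X ^+ p - 1] lowers the order by one,
    and what remains is divisible by [p]. *)
Let power_reduce j : exists2 c, stable c &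
  forall v, aug_killed M j.+1 v ->
    aug_killed M j ((X - 1) ^+ p * v - p%:R * c * v).
Proof.
have [c] := expr1D_prime (X - 1) p_pr; rewrite addrCA subrr addr0 => e.
exists (- \sum_(i < p) (X - 1) ^+ i *+ c i) => [|v kv].
  by apply: stableN; apply: stable_sum => i; apply: stableMn; apply: stableXn.
rewrite -mulrBl mulrN opprK.
have -> : (X - 1) ^+ p + p%:R * \sum_(i < p) (X - 1) ^+ i *+ c i = X ^+ p - 1.
  by rewrite e -(addrA 1) [1 + _]addrC addrK.
by rewrite -exprf //; apply: aug_killedS.
Qed.

Let power_killed j v : aug_killed M j.+1 v ->
  aug_killed M j ((X - 1) ^+ (p * k) * v).
Proof.
move=> kv; have [c sc cv] := power_reduce j.
have spc : stable (p%:R * c) by rewrite mulr_natl; apply: stableMn.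
(* On the quotient of consecutive layers [(X - 1) ^+ p] acts as [p%:R * c], whose [k]-th power
   vanishes with [p%:R ^+ k]. *)
suff: aug_killed M j (((X - 1) ^+ p) ^+ k * v - (p%:R * c) ^+ k * v).
  rewrite exprMn_comm; last exact/commr_sym/commr_nat.
  by rewrite pk0 !mul0r subr0 exprM.
elim: k => [|n IH]; first by rewrite subrr; apply: aug_killed0.
have [_ sp] := stableXn p stableB1.
have [_ sn] := stableXn n spc.
have := aug_killedD (sp _ _ IH) (cv _ (sn _ _ kv)).
by rewrite mulrBr addrA addrNK !mulrA -!exprS.
Qed.

(** Modulo layer [j] the product acts as a polynomial in [X] times [(X - 1) ^+ (p * k)], which sends
    layer [j.+1] into layer [j]. *)
Lemma maximal_step j v s : {subset s <= P} -> size s = (p * k)%N ->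
  aug_killed M j.+1 v -> aug_killed M j (aug_prod s * v).
Proof.
move=> sP ss kv; have [c [_ sc] cv] := reduce j sP.
have := aug_killedD (cv _ kv) (sc _ _ (power_killed kv)).
by rewrite ss mulrA addrNK.
Qed.

End Generator.

Lemma maximal_aug_killed j v : aug_killed M j v -> aug_killed P (p * k * j) v.
Proof.
have /properP[_ [x xP xM]] := maxgroupp maxM.
elim: j v => [|j IH] v kv.
  move=> s; rewrite muln0 => /size0nil -> _.
  exact: (kv [::]).
(* The last [p * k] factors act first and bring [v] down one layer; the induction hypothesis handles
   the others. *)
move=> s ss sP; rewrite -(cat_take_drop (p * k * j) s) /aug_prod big_cat.
have le : (p * k * j <= size s)%N by rewrite ss leq_mul2l leqnSn orbT.
rewrite -mulrA IH //; first apply: (maximal_step xP xM) => //.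
- by move=> y /mem_drop/sP.
- by rewrite size_drop ss mulnS addnK.
- by rewrite size_takel.
- by move=> y /mem_take/sP.
Qed.

End PGroupStep.

Lemma pgroup_aug_nilpotent (p : nat) (P : {group gT}) :
  prime p -> nilpotents S p%:R -> p.-group%g P ->
  f 1%g = 1 -> {in P &, forall x y, f (x * y)%g = f x * f y} ->
  exists n, forall v, aug_killed P n v.
Proof.
move=> p_pr [k pk0] + f1.
have [n] := ubnP #|P|; elim: n P => // n IH P leP pP fM.
have [P1|ntP] := eqVneq (P : {set gT}) [1 gT]%g.
  (* In the trivial group a single factor is already [f 1 - 1 = 0]. *)
  exists 1 => v [|x []] // _ sP.
  have : x \in (P : {set gT}) by apply: sP; rewrite mem_head.
  rewrite P1 => /set1P ->.
  by rewrite /aug_prod big_seq1 f1 subrr mul0r.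
have [|M maxM _] := @maxgroup_exists gT (fun H => H \proper P) 1%G.
  by rewrite /= proper1G.
have prM := maxgroupp maxM; have sMP := proper_sub prM.
have [N kN] : exists n, forall v, aug_killed M n v.
  apply: IH (pgroupS sMP pP) _; first exact: leq_trans (proper_card prM) leP.
  by move=> x y xM yM; apply: fM; apply: (subsetP sMP).
by exists (p * k * N)%N => v; apply: (maximal_aug_killed p_pr pk0 pP maxM).
Qed.

End AugmentationProducts.

(** * Lifting along a split surjection with nil kernel *)

Lemma unitsM (R : pzRingType) (u v : R) : units R u -> units R v -> units R (u * v).
Proof.
move=> [u' [uu u'u]] [v' [vv v'v]]; exists (v' * u'); split.
  by rewrite mulrA -[u * v * v']mulrA vv mulr1.
by rewrite mulrA -[v' * u' * u]mulrA u'u mulr1.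
Qed.

(** The inverse is the terminating geometric series in [- x]. *)
Lemma units_1D_nilpotent (R : pzRingType) (x : R) :
  nilpotents R x -> units R (1 + x).
Proof.
move=> [n xn0]; have e := subrX1 (- x) n.
have xNn : (- x) ^+ n = 0 by rewrite exprNn xn0 mulr0.
exists (\sum_(i < n) (- x) ^+ i).
have c : GRing.comm (1 + x) (\sum_(i < n) (- x) ^+ i).
  apply: commr_sum => i _; apply/commrX/commrN/commr_sym/commrD => //.
  exact: commr1.
suff e1 : (1 + x) * (\sum_(i < n) (- x) ^+ i) = 1 by rewrite -c e1.
by apply: oppr_inj; rewrite -mulNr opprD addrC -e xNn sub0r.
Qed.

Section NilExtension.
Variables (S R : pzRingType) (e : {rmorphism S -> R}) (i : {rmorphism R -> S}).
Hypothesis iK : cancel i e.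
Hypothesis nil_ker : forall d, e d = 0 -> nilpotents S d.

(** Otherwise the left ideal [I + S d] strictly contains [I]. It is proper: [1 - b * d] in [I] is
    impossible, being a unit because [b * d] is in the nil kernel. *)
Lemma nil_ker_maximal (I : set S) : maximal_left_ideal I ->
  forall d, e d = 0 -> I d.
Proof.
move=> [[I0 IB IM] IT Imax] d d0; apply: contrapT => nId.
pose K : set S := [set a | exists b, I (a - b * d)]%classic.
have KI : K = I.
  apply: Imax.
  - split.
    + by exists 0; rewrite mul0r subrr.
    + move=> x y [b xb] [c yc]; exists (b - c).
      have -> : x - y - (b - c) * d = x - b * d - (y - c * d).
        by rewrite mulrBl !opprB addrACA [RHS]addrACA [- y - _]addrC.
      exact: IB.
    + by move=> a x [b xb]; exists (a * b); rewrite -mulrA -mulrBr; apply: IM.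
  - move=> KT; have [b Ib] : K 1 by rewrite KT.
    have /units_1D_nilpotent [w [_ wu]] : nilpotents S (- (b * d)).
      by apply: nil_ker; rewrite rmorphN rmorphM d0 mulr0 oppr0.
    apply: IT; apply/seteqP; split=> // x _.
    by rewrite -[x]mulr1 -wu mulrA; apply: IM.
  - by move=> x Ix; exists 0; rewrite mul0r subr0.
by apply: nId; rewrite -KI; exists 1; rewrite mul1r subrr.
Qed.

(** Maximal left ideals of [S] contain the kernel, so they correspond to maximal left ideals of [R]
    by pulling back along [i]. *)
Lemma nil_ker_jacobson x : jacobson_radical R (e x) -> jacobson_radical S x.
Proof.
move=> Jx I mI; have kerI := nil_ker_maximal mI.
have [[I0 IB IM] IT Imax] := mI.
have ID a b : I a -> I b -> I (a + b).
  by move=> Ia Ib; have := IB _ _ Ia (IB _ _ I0 Ib); rewrite sub0r opprK.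
have IP a : I (i (e a)) <-> I a.
  have k : e (a - i (e a)) = 0 by rewrite rmorphB iK subrr.
  split=> Ia; first by rewrite -(subrK (i (e a)) a); apply: ID => //; apply: kerI.
  by rewrite -[i _](subKr a); apply: IB => //; apply: kerI.
suff : I (i (e x)) by move/IP.
apply: (Jx [set a | I (i a)]%classic); split.
- split=> /=; first by rewrite rmorph0.
    by move=> a b Ia Ib; rewrite rmorphB; apply: IB.
  by move=> a b Ib; rewrite rmorphM; apply: IM.
- move=> h; apply: IT; apply/seteqP; split=> // a _.
  by apply/IP; have : [set: R]%classic (e a) by []; rewrite -h.
- move=> K [K0 KB KM] KT sK.
  (* The pullback of [K] along [e] is a proper left ideal containing [I], so maximality of [I]
     applies to it. *)
  have h : [set a | K (e a)]%classic = I.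
    apply: Imax.
    + split=> /=; first by rewrite rmorph0.
        by move=> a b Ia Ib; rewrite rmorphB; apply: KB.
      by move=> a b Ib; rewrite rmorphM; apply: KM.
    + move=> h; apply: KT; apply/seteqP; split=> // a _.
      have : [set: S]%classic (i a) by [].
      by rewrite -h /= iK.
    + by move=> a /IP Ia; apply: sK.
  by rewrite -h; apply/seteqP; split=> a /=; rewrite iK.
Qed.

Lemma nil_ker_generalized_fine : generalized_fine R -> generalized_fine S.
Proof.
move=> fineR x nJx.
have /fineR[u [v [Uu [n vn] e_x]]] : ~ jacobson_radical R (e x).
  by move/nil_ker_jacobson.
exists (x - i v), (i v); split; last by rewrite subrK.
- have [u' [uu' u'u]] := Uu.
  (* [i u' * (x - i v)] differs from [1] by a kernel element, hence is a unit; multiplying by the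
     unit [i u] recovers [x - i v]. *)
  have d0 : e (i u' * (x - i v) - 1) = 0.
    by rewrite rmorphB rmorphM rmorphB !iK rmorph1 e_x addrK u'u subrr.
  have /units_1D_nilpotent := nil_ker d0; rewrite addrC subrK => Uw.
  have -> : x - i v = i u * (i u' * (x - i v)).
    by rewrite mulrA -rmorphM uu' rmorph1 mul1r.
  apply: unitsM => //; exists (i u').
  by rewrite -!rmorphM uu' u'u rmorph1.
- by exists n; rewrite -rmorphXn vn rmorph0.
Qed.

End NilExtension.

(** * Finite subgroups as permutation groups *)

Section FiniteSubgroups.
Variables (G : groupType) (X : {fset G}).
Hypothesis gX : is_subgroup [set` X]%classic.

(* Cayley: [X] acts on itself by right translations. *)
Lemma finite_subgroup_perm : exists (P : {group {perm X}}) (f : {perm X} -> G),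
  [/\ {in P &, forall s t, f (s * t)%g = (f s * f t)%g}, f 1%g = 1%g,
      {in P, forall s, f s = 1%g -> s = 1%g}
    & forall g, g \in X -> exists2 s, s \in P & f s = g].
Proof.
have [X1 XM XV] := gX.
pose one : X := [` X1 : 1%g \in X]%fset.
pose tr (h g : X) : X := [` XM _ _ (fsvalP g) (fsvalP h) : (val g * val h)%g \in X]%fset.
have tr_inj h : injective (tr h).
  by move=> g g' /(congr1 val)/= /mulIg/val_inj.
pose s h := perm (@tr_inj h).
have sM h h' : (s h * s h')%g = s (tr h' h).
  apply/permP => g; rewrite permM !permE; apply: val_inj => /=.
  by rewrite mulgA.
have s1 : s one = 1%g.
  by apply/permP => g; rewrite permE perm1; apply: val_inj; rewrite /= mulg1.
have gP : group_set [set s h | h : X].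
  apply/group_setP; split; first by rewrite -s1 imset_f.
  by move=> _ _ /imsetP[h _ ->] /imsetP[h' _ ->]; rewrite sM imset_f.
(* A translation is recovered from the image of the identity; on other permutations [f] need not be
   multiplicative. *)
pose f (t : {perm X}) : G := val (t one).
have fs h : f (s h) = val h by rewrite /f permE /= mul1g.
exists (Group gP), f; split.
- move=> _ _ /imsetP[h _ ->] /imsetP[h' _ ->].
  by rewrite sM !fs.
- by rewrite /f perm1.
- move=> _ /imsetP[h _ ->]; rewrite fs => h1.
  by rewrite -s1; congr s; apply: val_inj.
- by move=> g gX'; exists (s [` gX']%fset); rewrite ?imset_f ?fs.
Qed.

End FiniteSubgroups.

(** * The augmentation of the group ring and its section by constants *)

Section Augmentation.
Variables (R : pzRingType) (G : groupType).
Local Notation RG := (group_ring R G).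

Definition gr_const (r : R) : RG := mkmalgU 1%g r.

Definition gr_elt (g : G) : RG := mkmalgU g 1.

Definition gr_aug (a : RG) : R := \sum_(g <- msupp a) mcoeff g a.

Lemma gr_augw (d : {fset G}) (a : RG) :
  (msupp a `<=` d)%fset -> gr_aug a = \sum_(g <- d) mcoeff g a.
Proof.
by move=> le; apply: big_fset_incl => // g _ /mcoeff_outdom.
Qed.

Lemma gr_augU g r : gr_aug (mkmalgU g r) = r.
Proof. by rewrite (gr_augw msuppU_le) big_seq_fset1 mcoeffUU. Qed.

Lemma gr_mulUUr g h (x y : R) :
  (mkmalgU g x : RG) * mkmalgU h y = mkmalgU (g * h)%g (x * y).
Proof. exact: gr_mulUU. Qed.

Lemma gr_augB : {morph gr_aug : a b / a - b}.
Proof.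
move=> a b; set d := (msupp a `|` msupp b)%fset.
have la : (msupp a `<=` d)%fset := fsubsetUl _ _.
have lb : (msupp b `<=` d)%fset := fsubsetUr _ _.
rewrite (gr_augw la) (gr_augw lb) (@gr_augw d) ?msuppB_le // -sumrB.
by apply: eq_bigr => g _; rewrite mcoeffB.
Qed.

HB.instance Definition _ := GRing.isZmodMorphism.Build RG R gr_aug gr_augB.

Lemma gr_aug_monoid : monoid_morphism gr_aug.
Proof.
split=> [|a b]; first exact: gr_augU.
elim/gr_ind: a => [|a a' IH IH'|g x].
- by rewrite mul0r raddf0 mul0r.
- by rewrite mulrDl !raddfD /= IH IH' mulrDl.
elim/gr_ind: b => [|b b' IH IH'|h y].
- by rewrite mulr0 raddf0 mulr0.
- by rewrite mulrDr !raddfD /= IH IH' mulrDr.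
by rewrite gr_mulUUr !gr_augU.
Qed.

HB.instance Definition _ := GRing.isMonoidMorphism.Build RG R gr_aug gr_aug_monoid.

Lemma gr_constB : {morph gr_const : a b / a - b}.
Proof. exact: monalgUB. Qed.

HB.instance Definition _ := GRing.isZmodMorphism.Build R RG gr_const gr_constB.

Lemma gr_const_monoid : monoid_morphism gr_const.
Proof. by split=> // a b; rewrite gr_mulUUr mulg1. Qed.

HB.instance Definition _ :=
  GRing.isMonoidMorphism.Build R RG gr_const gr_const_monoid.

Lemma gr_constK : cancel gr_const gr_aug.
Proof. by move=> r; apply: gr_augU. Qed.

Lemma gr_comm_const_elt r g : GRing.comm (gr_const r) (gr_elt g).
Proof. by rewrite /GRing.comm !gr_mulUUr mulr1 mul1r mulg1 mul1g. Qed.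

(** Subtracting the constant [gr_aug a], which is zero, turns each term [r g] of [a] into
    [r (g - 1)]. *)
Lemma gr_ker_augE (a : RG) : gr_aug a = 0 ->
  a = \sum_(g <- msupp a) gr_const (mcoeff g a) * (gr_elt g - 1).
Proof.
move=> a0; have e : gr_const (gr_aug a) = 0 by rewrite a0 raddf0.
transitivity (a - gr_const (gr_aug a)); first by rewrite e subr0.
rewrite /gr_aug raddf_sum {1}[a]monalgE -sumrB.
apply: eq_bigr => g _.
by rewrite mulrBr mulr1 gr_mulUUr mul1g mulr1.
Qed.

End Augmentation.

(** * Nilness of the augmentation kernel *)

Lemma generated_subgroupP (G : groupType) (A : set G) :
  is_subgroup (generated_subgroup A).
Proof.
split=> [H [[] //]|x y Hx Hy H HA|x Hx H HA]; have [[_ HM HV] _] := HA.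
  by apply: HM; [apply: Hx | apply: Hy].
by apply: HV; apply: Hx.
Qed.

(** By Cauchy a prime [q] dividing the order of [P] is the order of some [s]. Injectivity transfers
    the p-power order of [f s] to [s], so [q = p]. *)
Lemma pgroup_morph_elt (G : groupType) (gT : finGroupType) (P : {group gT})
    (f : gT -> G) (p : nat) : prime p -> is_pgroup G p ->
  {in P &, forall s t, f (s * t)%g = (f s * f t)%g} -> f 1%g = 1%g ->
  {in P, forall s, f s = 1%g -> s = 1%g} -> p.-group%g P.
Proof.
move=> p_pr pG fM f1 inj; apply/pgroupP => q q_pr /(Cauchy q_pr)[s sP so].
have [k [_ pk _]] := pG (f s).
have fX n : f (s ^+ n)%g = (f s ^+ n)%g.
  by elim: n => [|n IH]; rewrite ?expg0 // !expgS fM ?groupX ?IH.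
have : (s ^+ (p ^ k) == 1)%g.
  by apply/eqP/inj; rewrite ?groupX // fX.
rewrite -order_dvdn so Euclid_dvdX // => /andP[qp _].
by rewrite inE -dvdn_prime2.
Qed.

(** The support of [a] generates a finite subgroup; transporting it to a permutation group makes the
    bound for finite p-groups available. *)
Lemma gr_ker_aug_nilpotent (R : pzRingType) (G : groupType) (p : nat) :
  prime p -> locally_finite G -> is_pgroup G p -> nilpotents R p%:R ->
  forall a : group_ring R G, gr_aug a = 0 -> nilpotents (group_ring R G) a.
Proof.
move=> p_pr lfG pG [k pk0] a /gr_ker_augE ->.
have /lfG/finite_fsetP[X HX] : finite_set [set` msupp a]%classic.
  exact: finite_fset.
have sX g : g \in msupp a -> g \in X.
  move=> ga; suff : generated_subgroup [set` msupp a]%classic g by rewrite HX.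
  by move=> H [_]; apply.
have gX : is_subgroup [set` X]%classic.
  by rewrite -HX; apply: generated_subgroupP.
have [P [f [fM f1 f_inj f_onto]]] := finite_subgroup_perm gX.
have pP := pgroup_morph_elt p_pr pG fM f1 f_inj.
have pS : nilpotents (group_ring R G) p%:R.
  exists k; rewrite -(rmorph_nat (@gr_const R G)) -rmorphXn /= pk0.
  exact: raddf0.
have [||n kn] := @pgroup_aug_nilpotent _ _ (fun s => gr_elt R (f s)) p P p_pr pS pP.
- by rewrite f1.
- by move=> s t sP tP; rewrite fM // gr_mulUUr mulr1.
(* [s] picks preimages under [f], with default [1] outside [X], so that its values lie in [P] for
   every index. *)
have /choice[s sP] : forall g, exists s, s \in P /\ (g \in X -> f s = g).
  move=> g; have [/f_onto[t tP ft]|_] := boolP (g \in X); first by exists t.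
  by exists 1%g.
exists n; rewrite big_seq.
have -> : \sum_(g <- msupp a | g \in msupp a)
      gr_const G (mcoeff g a) * (gr_elt R g - 1) =
    \sum_(g <- msupp a) gr_const G (mcoeff g a) * (gr_elt R (f (s g)) - 1).
  rewrite [RHS]big_seq; apply: eq_bigr => g /sX gX'.
  by have [_ ->] := sP g.
apply: (aug_prod_nilpotent _ _ _ kn) => [g|g x _]; first by have [] := sP g.
exact: gr_comm_const_elt.
Qed.

Theorem theorem4p3 (R : pzRingType) (p : nat) (G : groupType) :
  prime p ->
  locally_finite G ->
  is_pgroup G p ->
  nilpotents R (p%:R)%R ->
  generalized_fine R ->
  generalized_fine (group_ring R G).
Proof.
move=> p_pr lfG pG pR; apply: (nil_ker_generalized_fine (@gr_constK R G)).
exact: gr_ker_aug_nilpotent pR.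
Qed.
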